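(* Let $d\ge1$ and let $\mathbf X_0$ be a random vector in $\mathbb R^d$ having a density $\pi$ with respect to Lebesgue measure. Let $r\in[2,\infty)$. If $\phi\in[0,1]$ is a number, and $\mathbf z$ and $\mathbf m$ are any deterministic vectors in $\mathbb R^d$, then $$\|\mathbf z\|^r\int_{\mathbb R^d}\min\{\phi\,\pi(\mathbf x),(1-\phi)\,\pi(\mathbf x-\mathbf z)\}\,d\mathbf x<2^{r-2}\,\mathbb E\|\mathbf X_0-\mathbf m\|^r.$$ Furthermore, for any nonzero $\mathbf c\in\mathbb R^d$ and $m\in\mathbb R$, $$|\langle\mathbf c,\mathbf z\rangle|^r\int_{\mathbb R^d}\min\{\phi\,\pi(\mathbf x),(1-\phi)\,\pi(\mathbf x-\mathbf z)\}\,d\mathbf x<2^{r-2}\,\mathbb E|\langle\mathbf c,\mathbf X_0\rangle-m|^r.$$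
   Context: $\langle\cdot,\cdot\rangle$ and $\|\cdot\|$ are the Euclidean inner product and norm. The right-hand sides are allowed to be $+\infty$. *)

(* Defs.v *)
From HB Require Import structures.
From mathcomp Require Import all_boot all_order all_algebra.
From mathcomp Require Import all_classical all_reals all_analysis.
Set Implicit Arguments.
Unset Strict Implicit.
Unset Printing Implicit Defensive.
Import Order.TTheory GRing.Theory Num.Theory.
Import numFieldNormedType.Exports.
Local Open Scope classical_set_scope.
Local Open Scope ring_scope.

(* Points of R^n are [n.-tuple R]; its canonical sigma-algebra is generated by
   the coordinate maps, i.e. it is the Borel sigma-algebra of R^n. *)

Section euclidean.
Context {R : realType} {n : nat}.
Implicit Types x y : n.-tuple R.

Definition zerov : n.-tuple R := [tuple 0 | i < n].

Definition subv x y : n.-tuple R := [tuple tnth x i - tnth y i | i < n].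

Definition dotv x y : R := \sum_(i < n) tnth x i * tnth y i.

Definition enorm x : R := Num.sqrt (dotv x x).

End euclidean.

Section lebesgue_tuple.
Context {R : realType}.
Local Open Scope ereal_scope.

Definition tcons n (p : measurableTypeR R * n.-tuple R) : n.+1.-tuple R :=
  [tuple of (p.1 : R) :: p.2].

Lemma measurable_tcons n :
  measurable_fun [set: measurableTypeR R * n.-tuple R] (@tcons n).
Proof.
apply: (@measurable_cons _ _ _ R (fst : measurableTypeR R * n.-tuple R -> R)).
  exact: (@measurable_fst _ _ (measurableTypeR R) (n.-tuple R)).
exact: measurable_snd.
Qed.

(* The measure on R^(n+1) is the image of lebesgue_measure \x lebesgue_tuple n
   under (t, x) |-> t :: x; R^0 carries the unit mass at its only point. *)
Fixpoint lebesgue_tuple (n : nat) : set (n.-tuple R) -> \bar R :=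
  match n with
  | 0 => \d_ ([tuple] : 0.-tuple R)
  | k.+1 => pushforward (lebesgue_measure \x @lebesgue_tuple k) (@tcons k)
  end.

Lemma sigma_finite_tcons n
    (mu : {sigma_finite_measure set (n.-tuple R) -> \bar R}) :
  sigma_finite setT (pushforward (lebesgue_measure \x mu) (@tcons n)).
Proof.
have /sigma_finiteP[F [TF ndF Foo]] := sigma_finiteT (@lebesgue_measure R).
have /sigma_finiteP[G [TG ndG Goo]] := sigma_finiteT mu.
pose u (x : n.+1.-tuple R) : measurableTypeR R * n.-tuple R :=
  (tnth x ord0, [tuple of behead x]).
have uK : cancel (@tcons n) u.
  move=> [a x]; rewrite /u /tcons/= tnth0; congr pair.
  by apply: val_inj.
have mu_ : measurable_fun setT u.
  apply: (@measurable_fun_pair _ _ _ (n.+1.-tuple R) (measurableTypeR R)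
    (n.-tuple R) (@tnth n.+1 R ^~ ord0) (fun x => [tuple of behead x])).
    exact: measurable_tnth.
  exact: measurable_behead.
exists (fun k => u @^-1` (F k `*` G k)).
  apply/seteqP; split => // x _.
  have : setT (u x).1 by [].
  rewrite TF => -[k _ Fk].
  have : setT (u x).2 by [].
  rewrite TG => -[l _ Gl].
  exists (maxn k l) => //; split.
    by move: Fk; exact/subsetPset/ndF/leq_maxl.
  by move: Gl; exact/subsetPset/ndG/leq_maxr.
move=> k; have [mF Fk] := Foo k; have [mG Gk] := Goo k; split.
  by rewrite -[X in measurable X]setTI; apply: mu_ => //; exact: measurableX.
rewrite /pushforward (_ : _ @^-1` _ = F k `*` G k).
  by rewrite product_measure1E// lte_mul_pinfty// ge0_fin_numE.
by rewrite -comp_preimage (_ : u \o @tcons n = id)//; apply/funext => y /=.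
Qed.

Lemma lebesgue_tuple_measure n :
  exists mu : {sigma_finite_measure set (n.-tuple R) -> \bar R},
    @lebesgue_tuple n = mu.
Proof.
elim: n => [|n [mu muE]] /=.
  by exists (\d_ ([tuple] : 0.-tuple R)).
rewrite muE.
pose nu : {measure set (n.+1.-tuple R) -> \bar R} :=
  measure_function_pushforward__canonical__measure_function_Measure
    (lebesgue_measure \x mu) (@measurable_tcons n).
pose nu0 : set (n.+1.-tuple R) -> \bar R :=
  pushforward (lebesgue_measure \x mu) (@tcons n).
pose nuM : isMeasure _ (n.+1.-tuple R) R nu0 := isMeasure.Build _ _ _ nu0
  (measure0 nu) (measure_ge0 nu) (@measure_semi_sigma_additive _ _ _ nu).
pose nu1 : {measure set (n.+1.-tuple R) -> \bar R} := HB.pack nu0 nuM.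
pose nuS := Measure_isSigmaFinite.Build _ _ _ nu1 (sigma_finite_tcons mu).
pose nu2 : {sigma_finite_measure set (n.+1.-tuple R) -> \bar R} :=
  HB.pack nu0 nuM nuS.
by exists nu2.
Qed.

Section instances.
Variable n : nat.

Let lebesgue_tuple0 : @lebesgue_tuple n set0 = 0.
Proof. by have [mu ->] := lebesgue_tuple_measure n; exact: measure0. Qed.

Let lebesgue_tuple_ge0 A : 0 <= @lebesgue_tuple n A.
Proof. by have [mu ->] := lebesgue_tuple_measure n; exact: measure_ge0. Qed.

Let lebesgue_tuple_sigma_additive : semi_sigma_additive (@lebesgue_tuple n).
Proof.
have [mu ->] := lebesgue_tuple_measure n.
exact: measure_semi_sigma_additive.
Qed.

HB.instance Definition _ := isMeasure.Build _ _ _ (@lebesgue_tuple n)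
  lebesgue_tuple0 lebesgue_tuple_ge0 lebesgue_tuple_sigma_additive.

Let lebesgue_tuple_sigma_finite : sigma_finite setT (@lebesgue_tuple n).
Proof.
by have [mu ->] := lebesgue_tuple_measure n; exact: sigma_finiteT.
Qed.

HB.instance Definition _ := Measure_isSigmaFinite.Build _ _ _
  (@lebesgue_tuple n) lebesgue_tuple_sigma_finite.

End instances.

Lemma lebesgue_tuple_box n (A : 'I_n -> set R) :
  (forall i, measurable (A i)) ->
  lebesgue_tuple [set x | forall i, A i (tnth x i)] =
  \prod_(i < n) lebesgue_measure (A i).
Proof.
elim: n A => [|n IHn] A mA.
  by rewrite big_ord0 /= diracE mem_set// => -[].
rewrite big_ord_recl -IHn// -(@product_measure1E _ _ (measurableTypeR R)
  (n.-tuple R) R lebesgue_measure (@lebesgue_tuple n)) //=.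
- rewrite /pushforward; congr (product_measure1 _ _ _).
  apply/seteqP; split => -[a x] /=.
    move=> h; split; first by have := h ord0; rewrite tnth0.
    by move=> i; have := h (lift ord0 i); rewrite tnthS.
  move=> [Aa Ax] i.
  by case: (unliftP ord0 i) => [j|] ->; rewrite ?tnthS ?tnth0.
- exact: mA.
- rewrite (_ : mkset _ = \bigcap_(i in [set: 'I_n])
      ((fun x : n.-tuple R => tnth x i) @^-1` A (lift ord0 i))); last first.
    by apply/seteqP; split => x Ax i; [move=> _; exact: Ax|exact: (Ax i I)].
  apply: fin_bigcap_measurable => // i _.
  by rewrite -[X in measurable X]setTI; exact: measurable_tnth.
Qed.

End lebesgue_tuple.
Arguments lebesgue_tuple {R} n.

Definition is_density {d d' : measure_display} {T : measurableType d}
    {U : measurableType d'} {R : realType} (P : probability T R)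
    (mu : {measure set U -> \bar R}) (X : {RV P >-> U}) (f : U -> R) : Prop :=
  [/\ measurable_fun [set: U] f,
      forall x, 0 <= f x &
      forall A : set U, measurable A ->
        distribution P X A = (\int[mu]_(x in A) (f x)%:E)%E].

(* Main.v *)
Require Import Defs.
From mathcomp Require Import all_boot all_order all_algebra.
From mathcomp Require Import all_classical all_reals all_analysis.
From mathcomp Require Import measurable_realfun ring lra.

(** Write [pi] for the density [f], and for [L = <c, z>], nonzero, put
    [k x = (<c, x> - m) / L], so that [k (x - z) = k x - 1].  The second bound
    is the integral of the pointwise inequality
[[
    min (phi pi(x)) ((1 - phi) pi(x - z))
      <= 2^(r-2) (k(x)_+^r pi(x) + k(x - z)_-^r pi(x - z)),
]]
    in which [u_+] and [u_-] are the positive and negative parts.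
    By translation invariance of Lebesgue measure the two terms on the right
    integrate to the moments of [k(X)_+] and [k(X)_-], whose sum is
    [E |k(X)|^r].  Charging [pi(x)] only where [k > 0] and [pi(x - z)] only
    where the shifted [k] is negative is what saves a factor 2 over the
    estimate coming from [|L|^r <= 2^(r-1) (|L k(x)|^r + |L k(x - z)|^r)].

    The pointwise inequality ([min_le_weighted_powR]) is immediate unless
    [0 < y < 1], where [y = k x].  There both arguments of the minimum [g]
    bound it, so that it suffices to know
    [2^(r-2) (y^r / phi + (1 - y)^r / (1 - phi)) >= 1].  This follows
    from the Cauchy-Schwarz inequality, which bounds the bracket below by
    [(y^(r/2) + (1 - y)^(r/2))^2], and from the convexity of [t^(r/2)].

    Strictness: where the majorant is positive, equality forces [y] to be one
    particular number [y0], that is, [x] to lie on a fixed hyperplane, which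
    is Lebesgue-null ([lebesgue_tuple_hyperplane0]).  The majorant has positive
    integral because [X] charges no hyperplane, and the minimum has finite
    integral, so the integrals differ ([ge0_integral_lt]); this covers an
    infinite moment as well.  When [L = 0] the left-hand side vanishes and only
    the positivity of the moment matters.

    The first bound is the second one for [<c, m>] and a nonzero [c] with
    [|<c, z>| = |c| |z|], followed by [|<c, X - m>| <= |c| |X - m|] and
    cancellation of [|c|^r]. *)

Set Implicit Arguments.
Unset Strict Implicit.
Unset Printing Implicit Defensive.
Import Order.TTheory GRing.Theory Num.Theory.
Import numFieldNormedType.Exports.
Local Open Scope classical_set_scope.
Local Open Scope ring_scope.

(** * Euclidean vectors *)

Section euclidean_tuple.
Context {R : realType} {n : nat}.
Implicit Types x y z c : n.-tuple R.

Lemma dotv_subv c x y : dotv c (subv x y) = dotv c x - dotv c y.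
Proof.
rewrite /dotv -sumrB; apply: eq_bigr => i _.
by rewrite tnth_mktuple mulrBr.
Qed.

Lemma dotv_ge0 x : 0 <= dotv x x.
Proof. by apply: sumr_ge0 => i _; rewrite -expr2 sqr_ge0. Qed.

Lemma enorm_ge0 x : 0 <= enorm x. Proof. exact: sqrtr_ge0. Qed.

Lemma enorm_gt0 x : x <> zerov -> 0 < enorm x.
Proof.
move=> x0; rewrite sqrtr_gt0 lt0r dotv_ge0 andbT; apply/eqP => xx0; apply: x0.
apply: eq_from_tnth => i; rewrite tnth_mktuple.
move/eqP: xx0; rewrite psumr_eq0 => [|j _]; last by rewrite -expr2 sqr_ge0.
by move=> /allP/(_ i); rewrite mem_index_enum mulf_eq0 orbb => /(_ isT)/eqP.
Qed.

(** By Lagrange's identity, [|x|^2 |y|^2 - <x, y>^2] is half a double sum of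
    squares. *)
Lemma dotv_cauchy_schwarz x y : `|dotv x y| <= enorm x * enorm y.
Proof.
rewrite /enorm -sqrtrM ?dotv_ge0// -sqrtr_sqr ler_wsqrtr//.
have lagrange : \sum_(i < n) \sum_(j < n)
    (tnth x i * tnth y j - tnth x j * tnth y i) ^+ 2 =
    (dotv x x * dotv y y - dotv x y ^+ 2) * 2.
  rewrite mulr2n mulrDr mulr1 {1}(mulrC (dotv x x)) addrACA -opprD.
  rewrite expr2 /dotv !big_distrlr -!big_split -sumrB /=.
  apply: eq_bigr => i _; rewrite -!big_split -sumrB /=.
  by apply: eq_bigr => j _; ring.
have : 0 <= (dotv x x * dotv y y - dotv x y ^+ 2) * 2.
  rewrite -lagrange; apply: sumr_ge0 => i _; apply: sumr_ge0 => j _.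
  exact: sqr_ge0.
by rewrite pmulr_lge0// subr_ge0.
Qed.

Lemma dotv_self x : dotv x x = enorm x * enorm x.
Proof. by rewrite -expr2 sqr_sqrtr// dotv_ge0. Qed.

Lemma measurable_subv z :
  measurable_fun [set: n.-tuple R] (subv ^~ z).
Proof.
apply/measurable_fun_tnthP => i.
rewrite (_ : _ \o _ = fun x : n.-tuple R => (tnth x i - tnth z i)%R).
  by apply: measurable_funB => //; exact: measurable_tnth.
by apply/funext => x; rewrite /= tnth_mktuple.
Qed.

Lemma measurable_dotv c :
  measurable_fun [set: n.-tuple R] (dotv c).
Proof.
apply: measurable_sum => i; apply: measurable_funM => //.
exact: measurable_tnth.
Qed.

Lemma measurable_enorm : measurable_fun [set: n.-tuple R] (@enorm R n).
Proof.
apply: measurableT_comp.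
  exact: (continuous_measurable_fun (@sqrt_continuous R)).
apply: measurable_sum => i.
by apply: measurable_funM => //; exact: measurable_tnth.
Qed.

End euclidean_tuple.

(** * Lebesgue measure: translations and hyperplanes *)

Section lebesgue.
Context {R : realType}.
Local Open Scope ereal_scope.
Local Notation lambda := (@lebesgue_measure R).

(** The image of Lebesgue measure under a translation gives every half-open
    interval its length, so it is Lebesgue measure. *)
Lemma ge0_integral_lebesgue_shift (a : R) (h : R -> \bar R) :
  measurable_fun [set: R] h -> (forall t, 0 <= h t) ->
  \int[lambda]_t h (t - a)%R = \int[lambda]_t h t.
Proof.
move=> mh h0.
pose T : measurableTypeR R -> measurableTypeR R := fun t => (t - a)%R.
have mT : measurable_fun [set: measurableTypeR R] T by exact: measurable_funB.
transitivity (\int[pushforward lambda T]_t h t).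
  apply/esym; rewrite [LHS](@ge0_integral_pushforward _ _ (measurableTypeR R)
    (measurableTypeR R) R T mT lambda setT h)//.
apply: eq_measure_integral => A mA _.
apply/esym/lebesgue_measure_unique => // _ [[u v] _ <-] /=.
rewrite /pushforward (_ : _ @^-1` _ = `](u + a)%R, (v + a)%R]%classic).
  rewrite !lebesgue_measure_itv/= !lte_fin ltrD2r; case: ifPn => // _.
  by congr _%:E; ring.
by apply/seteqP; split => x /=; rewrite !in_itv/= ltrBrDr lerBlDr.
Qed.

Lemma ge0_integral_lebesgue_tupleS n (h : n.+1.-tuple R -> \bar R) :
  measurable_fun setT h -> (forall x, 0 <= h x) ->
  \int[lebesgue_tuple n.+1]_x h x =
  \int[lambda \x lebesgue_tuple n]_p h (tcons p).
Proof.
move=> mh h0.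
have := @ge0_integral_pushforward _ _ _ _ R _ (@measurable_tcons R n)
  (lambda \x lebesgue_tuple n) setT h measurableT mh.
rewrite preimage_setT => E.
transitivity
  (\int[pushforward (lambda \x lebesgue_tuple n) (@tcons R n)]_x h x).
  by [].
by rewrite E// => x _.
Qed.

Lemma tonelli1_lebesgue_tuple n (h : n.+1.-tuple R -> \bar R) :
  measurable_fun setT h -> (forall x, 0 <= h x) ->
  \int[lebesgue_tuple n.+1]_x h x =
  \int[lambda]_t \int[lebesgue_tuple n]_x h (tcons (t, x)).
Proof.
move=> mh h0; rewrite ge0_integral_lebesgue_tupleS//.
rewrite (fubini_tonelli1 (h \o @tcons R n))//.
  exact: measurableT_comp mh (@measurable_tcons R n).
by move=> p; exact: h0.
Qed.

Lemma tonelli2_lebesgue_tuple n (h : n.+1.-tuple R -> \bar R) :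
  measurable_fun setT h -> (forall x, 0 <= h x) ->
  \int[lebesgue_tuple n.+1]_x h x =
  \int[lebesgue_tuple n]_x \int[lambda]_t h (tcons (t, x)).
Proof.
move=> mh h0; rewrite ge0_integral_lebesgue_tupleS//.
rewrite (fubini_tonelli2 (h \o @tcons R n))//.
  exact: measurableT_comp mh (@measurable_tcons R n).
by move=> p; exact: h0.
Qed.

Lemma tnth_beheadS n (c : n.+1.-tuple R) (i : 'I_n) :
  tnth [tuple of behead c] i = tnth c (lift ord0 i).
Proof. by case/tupleP: c => a c; rewrite !(tnth_nth a). Qed.

Lemma subv_tcons n (t : R) (x : n.-tuple R) (z : n.+1.-tuple R) :
  subv (tcons (t, x)) z =
  tcons ((t - tnth z ord0)%R, subv x [tuple of behead z]).
Proof.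
apply: eq_from_tnth => i; rewrite tnth_mktuple.
case: (unliftP ord0 i) => [j|] ->; rewrite ?tnthS ?tnth0//=.
by rewrite tnth_mktuple tnth_beheadS.
Qed.

Lemma dotv_tcons n (c : n.+1.-tuple R) (t : R) (x : n.-tuple R) :
  dotv c (tcons (t, x)) =
  (tnth c ord0 * t + dotv [tuple of behead c] x)%R.
Proof.
rewrite /dotv big_ord_recl tnth0; congr (_ + _)%R.
by apply: eq_bigr => i _; rewrite tnthS tnth_beheadS.
Qed.

Lemma ge0_integral_lebesgue_tuple_shift n (z : n.-tuple R)
    (h : n.-tuple R -> \bar R) :
  measurable_fun setT h -> (forall x, 0 <= h x) ->
  \int[lebesgue_tuple n]_x h (subv x z) = \int[lebesgue_tuple n]_x h x.
Proof.
elim: n z h => [|n IHn] z h mh h0.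
  by apply: eq_integral => x _; congr h; rewrite [RHS]tuple0; exact: tuple0.
have mhz : measurable_fun setT (fun x => h (subv x z)).
  exact: measurableT_comp mh (measurable_subv z).
rewrite !tonelli1_lebesgue_tuple//.
under eq_integral do under eq_integral do rewrite subv_tcons.
pose H t := \int[lebesgue_tuple n]_x h (tcons (t, x)).
have mH : measurable_fun [set: R] H.
  apply: (@measurable_fun_fubini_tonelli_F _ _ (measurableTypeR R) _ R
    (lebesgue_tuple n) (h \o @tcons R n)) => //.
    exact: measurableT_comp mh (@measurable_tcons R n).
  by move=> p; exact: h0.
rewrite -[RHS](ge0_integral_lebesgue_shift (tnth z ord0) mH).
  apply: eq_integral => t _.
  rewrite (IHn _ (fun x => h (tcons ((t - tnth z ord0)%R, x))))//.
  apply: measurableT_comp => //.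
  exact: measurableT_comp (@measurable_tcons R n) (pair1_measurable _).
by move=> t; exact: integral_ge0.
Qed.

(** Induction on the dimension, integrating the indicator one coordinate at a
    time.  If the first coefficient of [c] vanishes, each section along the
    remaining coordinates is a hyperplane of lower dimension; otherwise each
    line parallel to the first axis meets the hyperplane in one point. *)
Lemma lebesgue_tuple_hyperplane0 n (c : n.-tuple R) (m : R) :
  c <> zerov -> lebesgue_tuple n [set x | dotv c x = m] = 0.
Proof.
have mS k (e : k.-tuple R) a : measurable [set x | dotv e x = a].
  rewrite -[X in measurable X]setTI.
  exact: (measurable_dotv e measurableT (measurable_set1 a)).
elim: n c m => [c m []|n IHn c m c0].
  by rewrite [LHS]tuple0; exact/esym/tuple0.
pose h (x : n.+1.-tuple R) : \bar R := (\1_[set x | dotv c x = m] x)%:E.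
have mh : measurable_fun setT h.
  apply/measurable_EFinP; apply: measurable_indic; exact: mS.
have h0 x : 0 <= h x by rewrite lee_fin.
rewrite -[X in lebesgue_tuple _ X]setIT -integral_indic//; last exact: mS.
rewrite -/h.
have [c00|c00] := eqVneq (tnth c ord0) 0%R.
- have b0 : [tuple of behead c] <> zerov.
    move=> b0; apply: c0; apply: eq_from_tnth => i.
    rewrite tnth_mktuple; case: (unliftP ord0 i) => [j|] -> //.
    by rewrite -tnth_beheadS b0 tnth_mktuple.
  rewrite (tonelli1_lebesgue_tuple mh h0) integral0_eq// => t _.
  rewrite -[RHS](IHn _ m b0) -[in RHS](setIT (mkset _)) -integral_indic//;
    last exact: mS.
  apply: eq_integral => x _; congr (_%:E).
  rewrite !indicE; congr ((nat_of_bool _)%:R); apply/idP/idP;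
    rewrite !inE/= dotv_tcons;
    by rewrite c00 mul0r add0r.
- rewrite (tonelli2_lebesgue_tuple mh h0) integral0_eq// => x _.
  pose t0 := ((m - dotv [tuple of behead c] x) / tnth c ord0)%R.
  rewrite -[RHS](lebesgue_measure_set1 t0) -[in RHS](setIT [set _]).
  rewrite -integral_indic//.
  apply: eq_integral => t _; congr (_%:E).
  rewrite !indicE; congr ((nat_of_bool _)%:R); apply/idP/idP;
    rewrite !inE/= dotv_tcons.
    by rewrite /t0 => <-; rewrite addrK mulrAC mulfV ?mul1r.
  by move=> ->; rewrite /t0 mulrC divfK// subrK.
Qed.

End lebesgue.

(** * The pointwise inequality *)

Section pointwise.
Context {R : realType}.
Implicit Types y a b r p phi : R.

(** The power [y_+^r] of the positive part, since [0 `^ r = 0] for [r != 0]. *)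
Definition pos_powR r y : R := Num.max y 0 `^ r.

Lemma pos_powR_ge0 r y : 0 <= pos_powR r y.
Proof. exact: powR_ge0. Qed.

Lemma pos_powR_pos r y : 0 <= y -> pos_powR r y = y `^ r.
Proof. by move=> y0; rewrite /pos_powR max_l. Qed.

Lemma pos_powR_neg r y : r != 0 -> y <= 0 -> pos_powR r y = 0.
Proof. by move=> r0 y0; rewrite /pos_powR max_r// powR0. Qed.

Lemma powR_norm_split r y : r != 0 ->
  `|y| `^ r = pos_powR r y + pos_powR r (- y).
Proof.
move=> r0; case: (leP 0 y) => y0.
  by rewrite ger0_norm// pos_powR_pos// pos_powR_neg ?addr0// oppr_le0.
rewrite ltr0_norm// pos_powR_neg// ?(ltW y0)// add0r pos_powR_pos//.
by rewrite oppr_ge0 ltW.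
Qed.

(** Convexity of [t `^ p] at the midpoint of [y] and [1 - y], which is
    [1 / 2]. *)
Lemma powR_onem_ge p y : 1 <= p -> 0 <= y <= 1 ->
  2 `^ (1 - p) <= y `^ p + (1 - y) `^ p.
Proof.
move=> p1 /andP[y0 y1].
have h0 : (0 : R) <= 2^-1 by lra.
have h1 : (2^-1 : R) <= 1 by lra.
pose t := Itv01 h0 h1.
have : (2^-1 * y + (1 - 2^-1) * (1 - y)) `^ p <=
       2^-1 * y `^ p + (1 - 2^-1) * (1 - y) `^ p.
  by apply: (convex_powR p1 t); rewrite inE/= in_itv/= ?y0 ?subr_ge0 ?y1.
have -> : 1 - 2^-1 = 2^-1 :> R by lra.
rewrite -!mulrDr subrKC mulr1 -powR_inv1// -powRrM mulN1r => h.
rewrite powRD ?pnatr_eq0 ?implybT// powRr1//.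
by rewrite -ler_pdivlMl ?ltr0n// -[2^-1]powR_inv1.
Qed.

(** In the application [a] and [b] are the densities at [x] and [x - z] and [y]
    is the normalised position of [x] along [z].  If [y >= 1] the first
    argument of the minimum already suffices, if [y <= 0] the second one.  In
    between, both are combined, with the defect of Cauchy-Schwarz kept as an
    explicit square: it vanishes only when [(1 - phi) y^(r/2)] and
    [phi (1 - y)^(r/2)] agree, which singles out one [y], independent of
    [a] and [b]. *)
Lemma min_le_weighted_powR r phi : 2 <= r -> 0 <= phi <= 1 ->
  exists y0, forall a b y, 0 <= a -> 0 <= b ->
    let g := Num.min (phi * a) ((1 - phi) * b) in
    let h := 2 `^ (r - 2) * (pos_powR r y * a + pos_powR r (1 - y) * b) in
    g <= h /\ (y <> y0 -> 0 < h -> g < h).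
Proof.
move=> r2 /andP[phi0 phi1].
pose p := r / 2.
have p1 : 1 <= p by rewrite /p; lra.
have r0 : r != 0 by apply/eqP; lra.
have C1 : 1 <= 2 `^ (r - 2).
  rewrite -[leLHS](powRr0 2); apply: ler_powR; first by lra.
  by lra.
pose balanced y := 0 < y < 1 /\ (1 - phi) * y `^ p = phi * (1 - y) `^ p.
have [y0 y0P] : exists y0, forall y, balanced y -> y = y0 \/ ~ 0 < phi < 1.
  (* the balance equation compares an increasing and a decreasing function *)
  have [[y0 by0]|nb] := pselect (exists y0, balanced y0 /\ 0 < phi < 1).
    exists y0 => y by_; left; apply: contrapT => yy0.
    wlog : y y0 by0 by_ yy0 / y < y0.
      move=> wl; have [yy0'|yy0'|//] := ltgtP y y0; first exact: (wl y y0).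
      case: by0 => by0 p01; apply: (wl y0 y) => //; exact/nesym.
    case: by0 by_ => -[/andP[ly0 uy0] e0] /andP[p0' p1'] [/andP[ly uy] e] lt.
    have : y `^ p < y0 `^ p by apply: gt0_ltr_powR; rewrite ?nnegrE; lra.
    have : (1 - y0) `^ p < (1 - y) `^ p.
      by apply: gt0_ltr_powR; rewrite ?nnegrE; lra.
    nra.
  by exists 0 => y by_; right => p01; apply: nb; exists y.
exists y0 => a b y a0 b0 g h.
have h0 : 0 <= h.
  by apply: mulr_ge0; rewrite ?powR_ge0// addr_ge0 ?mulr_ge0 ?pos_powR_ge0.
have g0 : 0 <= g by rewrite /g le_min !mulr_ge0 ?subr_ge0.
have [gE|gn0] := eqVneq g 0; first by rewrite gE; split.
have {gn0 g0} g0 : 0 < g by rewrite lt0r gn0.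
have ga : g <= phi * a by rewrite ge_min lexx.
have gb : g <= (1 - phi) * b by rewrite ge_min lexx orbT.
have phi0' : 0 < phi.
  by rewrite lt0r phi0 andbT; apply: contraTneq ga => ->; rewrite mul0r -ltNge.
have phi1' : phi < 1.
  rewrite lt_neqAle phi1 andbT; apply: contraTneq gb => ->.
  by rewrite subrr mul0r -ltNge.
have a0' : 0 < a by nra.
have b0' : 0 < b by nra.
have [y1|y1] := leP 1 y.
  have yr : 1 <= y `^ r.
    by rewrite -[leLHS](powRr0 y); apply: ler_powR => //; lra.
  have : g < h; last by move=> gh; split => //; exact: ltW.
  apply: (@lt_le_trans _ _ a); first by nra.
  rewrite /h pos_powR_pos; last lra.
  rewrite pos_powR_neg//; last lra.
  by rewrite mul0r addr0 mulrA ler_peMl// mulr_ege1.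
have [yle0|ygt0] := leP y 0.
  have yr : 1 <= (1 - y) `^ r.
    by rewrite -[leLHS](powRr0 (1 - y)); apply: ler_powR; lra.
  have : g < h; last by move=> gh; split => //; exact: ltW.
  apply: (@lt_le_trans _ _ b); first by nra.
  rewrite /h pos_powR_neg//.
  rewrite pos_powR_pos//; last lra.
  by rewrite mul0r add0r mulrA ler_peMl// mulr_ege1.
rewrite /h !pos_powR_pos; [|lra..].
set s := y `^ p; set t := (1 - y) `^ p.
have sqr_powR u : 0 < u -> u `^ r = (u `^ p) ^+ 2.
  move=> u0; rewrite -powR_mulrn ?powR_ge0// -powRrM; congr (_ `^ _).
  by rewrite /p; field.
rewrite !sqr_powR ?subr_gt0// -/s -/t.
set C := 2 `^ _ in C1 *.
have Cst : 1 <= C * (s + t) ^+ 2.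
  have st : 2 `^ (1 - p) <= s + t by apply: powR_onem_ge => //; lra.
  have : (2 `^ (1 - p)) ^+ 2 <= (s + t) ^+ 2.
    by rewrite lerXn2r// ?nnegrE ?powR_ge0// addr_ge0 ?powR_ge0.
  rewrite -powR_mulrn ?powR_ge0// -powRrM => /(ler_wpM2l (powR_ge0 2 (r - 2))).
  rewrite -powRD ?pnatr_eq0 ?implybT//.
  by rewrite (_ : r - 2 + _ = 0) ?powRr0// /p; field.
(* [D] is the defect in Cauchy-Schwarz:
   [s^2 / phi + t^2 / (1 - phi) = (s + t)^2 + D] *)
pose D := ((1 - phi) * s - phi * t) ^+ 2 / (phi * (1 - phi)).
have D0 : 0 <= D by rewrite divr_ge0 ?sqr_ge0// mulr_ge0; lra.
have Cpos : 0 < C by apply: lt_le_trans C1.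
have gh : g * (1 + C * D) <= C * (s ^+ 2 * a + t ^+ 2 * b).
  apply: (@le_trans _ _ (g * (C * ((s + t) ^+ 2 + D)))).
    by rewrite ler_pM2l// mulrDr lerD2r.
  rewrite mulrCA ler_pM2l//.
  rewrite (_ : _ + D = s ^+ 2 / phi + t ^+ 2 / (1 - phi)); last first.
    by rewrite /D; field; apply/andP; split; rewrite ?gt_eqF// subr_gt0.
  rewrite mulrDr; apply: lerD; rewrite mulrCA ler_wpM2l ?sqr_ge0//.
    by rewrite ler_pdivrMr// mulrC.
  by rewrite ler_pdivrMr ?subr_gt0// mulrC.
split.
  apply: le_trans gh; rewrite ler_peMr ?(ltW g0)// lerDl.
  by rewrite mulr_ge0 ?(ltW Cpos).
move=> yy0 _; apply: lt_le_trans gh; rewrite ltr_pMr// ltrDl mulr_gt0//.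
apply: divr_gt0; last by rewrite mulr_gt0 ?subr_gt0.
rewrite exprn_even_gt0//= subr_eq0.
apply/eqP => bal; apply: yy0.
have [|//|[]] := y0P y; last by rewrite phi0'.
by split => //; rewrite ygt0.
Qed.

End pointwise.

(** * Strict comparison of integrals, and expectations against a density *)

Section strict_integral.
Local Open Scope ereal_scope.

(** Were the integrals equal, [h - g] would vanish almost everywhere, which off
    [N] can only happen where [h] does; then [h] would have zero integral. *)
Lemma ge0_integral_lt d (T : measurableType d) (R : realType)
    (mu : {measure set T -> \bar R}) (g h : T -> R) (N : set T) :
  measurable_fun setT g -> measurable_fun setT h ->
  (forall x, (0 <= g x <= h x)%R) ->
  measurable N -> mu N = 0 -> (forall x, ~ N x -> (0 < h x -> g x < h x)%R) ->
  \int[mu]_x (g x)%:E < +oo -> 0 < \int[mu]_x (h x)%:E ->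
  \int[mu]_x (g x)%:E < \int[mu]_x (h x)%:E.
Proof.
move=> mg mh gh mN N0 ltgh goo hpos; rewrite ltNge; apply/negP => hg.
have g0 x : (0 <= g x)%R by case/andP: (gh x).
have h0 x : (0 <= h x)%R by case/andP: (gh x) => /le_trans; exact.
have d0 x : (0 <= h x - g x)%R by rewrite subr_ge0; case/andP: (gh x).
have mEg : measurable_fun setT (EFin \o g) by exact/measurable_EFinP.
have mEh : measurable_fun setT (EFin \o h) by exact/measurable_EFinP.
have mEd : measurable_fun setT (EFin \o (fun x => h x - g x)%R).
  by apply/measurable_EFinP; exact: measurable_funB.
have hE : \int[mu]_x (h x)%:E =
    \int[mu]_x (g x)%:E + \int[mu]_x (h x - g x)%:E.
  rewrite -ge0_integralD//; last 2 first.
  - by move=> x _; rewrite lee_fin.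
  - by move=> x _; rewrite lee_fin.
  by apply: eq_integral => x _; rewrite -EFinD subrKC.
have dint0 : \int[mu]_x `|(h x - g x)%:E| = 0.
  under eq_integral do rewrite gee0_abs ?lee_fin//.
  apply/eqP; rewrite eq_le integral_ge0 ?andbT; last first.
    by move=> x _; rewrite lee_fin.
  move: hg; rewrite hE -[leRHS]adde0 leeD2lE// ge0_fin_numE//.
  by apply: integral_ge0 => x _; rewrite lee_fin.
have [M [mM M0 dM]] := (ae_eq_integral_abs mu measurableT mEd).1 dint0.
suff h_ae0 : ae_eq mu setT (EFin \o h) (cst 0).
  move: hpos; rewrite (ae_eq_integral (cst 0))// integral0 ltxx//.
exists (M `|` N); split.
- exact: measurableU.
- by rewrite measureU0.
- move=> x /= /not_implyP[_ hx]; apply: contrapT => /not_orP[Mx Nx].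
  have hx0 : (0 < h x)%R.
    by rewrite lt0r h0 andbT; apply/eqP => e; apply: hx; rewrite e.
  apply: Mx; apply: dM => /= /(_ I) [] /eqP; rewrite subr_eq0 => /eqP e.
  by have := ltgh x Nx hx0; rewrite e ltxx.
Qed.

End strict_integral.

Section density.
Local Open Scope ereal_scope.
Context {dT dU : measure_display} {T : measurableType dT}
  {U : measurableType dU} {R : realType} {P : probability T R}
  {mu : {sigma_finite_measure set U -> \bar R}} {X : {RV P >-> U}} {f : U -> R}.
Hypothesis fX : is_density mu X f.

Lemma integral_density : \int[mu]_x (f x)%:E = 1.
Proof.
by case: fX => _ _ <- //; exact: probability_setT.
Qed.

(** The density has the same integral over every measurable set as the
    Radon-Nikodym derivative of the law of [X], so they agree almost everywhere
    and the change of variables for the derivative transfers. *)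
Lemma ge0_expectation_density (h : U -> R) :
  measurable_fun setT h -> (forall x, 0 <= h x)%R ->
  'E_P[h \o X] = \int[mu]_x (h x * f x)%:E.
Proof.
case: fX => mf f0 fP mh h0.
have mEf : measurable_fun setT (EFin \o f) by exact/measurable_EFinP.
have mEh : measurable_fun setT (EFin \o h) by exact/measurable_EFinP.
pose nu : {finite_measure set U -> \bar R} := distribution P X.
have numu : nu `<< mu.
  apply/null_content_dominatesP => A mA A0; rewrite [LHS]fP//.
  by apply: null_set_integral => //; exact/measurable_funTS.
have fRN : ae_eq mu setT (Radon_Nikodym_SigmaFinite.f nu mu) (EFin \o f).
  apply: integral_ae_eq => //.
    exact: Radon_Nikodym_SigmaFinite.f_integrable.
  move=> A _ mA; rewrite -Radon_Nikodym_SigmaFinite.f_integral//.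
  exact: fP.
rewrite unlock.
transitivity (\int[nu]_x (h x)%:E).
  by rewrite ge0_integral_distribution// => x; rewrite lee_fin.
rewrite -(Radon_Nikodym_SigmaFinite.change_of_variables numu)//.
have mRN := measurable_int _ (Radon_Nikodym_SigmaFinite.f_integrable numu).
apply: ae_eq_integral => //.
- exact: emeasurable_funM.
- by apply/measurable_EFinP; exact: measurable_funM.
- exact: (ae_eqe_mul2l _ fRN).
Qed.

End density.

(** * The overlap of a density with its translate *)

Section overlap.
Local Open Scope ereal_scope.
Context {R : realType} {d : nat} {disp : measure_display}
  {Omega : measurableType disp} {P : probability Omega R}
  {X : {RV P >-> d.-tuple R}} {f : d.-tuple R -> R}.
Hypothesis fX : is_density (lebesgue_tuple d) X f.
Local Notation lambda := (lebesgue_tuple d).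

Lemma measurable_affine_powR (c : d.-tuple R) (m r : R) :
  measurable_fun [set: d.-tuple R] (fun x => `|dotv c x - m| `^ r)%R.
Proof.
apply: (@measurableT_comp _ _ _ _ _ _ (fun a => a `^ r)%R);
  first exact: measurable_powR.
apply: measurableT_comp => //.
apply: measurable_funB => //; exact: measurable_dotv.
Qed.

Lemma expectation_affine_powR (c : d.-tuple R) (m r : R) :
  'E_P[fun w => `|dotv c (X w) - m| `^ r]%R =
  \int[lambda]_x (`|dotv c x - m| `^ r * f x)%:E.
Proof.
apply: (ge0_expectation_density fX) => [|x]; last exact: powR_ge0.
exact: measurable_affine_powR.
Qed.

(** A zero moment would make the density vanish almost everywhere off the
    hyperplane [<c, x> = m], hence almost everywhere. *)
Lemma expectation_affine_powR_gt0 (c : d.-tuple R) (m r : R) :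
  c <> zerov -> 0 < 'E_P[fun w => `|dotv c (X w) - m| `^ r]%R.
Proof.
move=> c0; rewrite expectation_affine_powR.
have [mf f0 _] := fX.
have mH : measurable [set x | dotv c x = m].
  rewrite -[X in measurable X]setTI.
  exact: (measurable_dotv c measurableT (measurable_set1 m)).
have mh : measurable_fun setT (fun x => (`|dotv c x - m| `^ r * f x)%:E).
  apply/measurable_EFinP; apply: measurable_funM => //.
  exact: measurable_affine_powR.
have h0 x : (0 <= `|dotv c x - m| `^ r * f x)%R.
  by rewrite mulr_ge0 ?powR_ge0.
rewrite lt0e integral_ge0 ?andbT => [|x _]; last by rewrite lee_fin.
apply/eqP => I0.
have [|M [mM M0 hM]] := (ae_eq_integral_abs lambda measurableT mh).1.
  by under eq_integral do rewrite gee0_abs ?lee_fin//.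
have f_ae0 : ae_eq lambda setT (EFin \o f) (cst 0).
  exists (M `|` [set x | dotv c x = m]); split.
  - exact: measurableU.
  - by rewrite measureU0//; exact: lebesgue_tuple_hyperplane0.
  - move=> x /= /not_implyP[_ fx]; apply: contrapT => /not_orP[Mx Hx].
    apply: Mx; apply: hM => /= /(_ I) [] /eqP; rewrite mulf_eq0.
    rewrite gt_eqF/=; last by rewrite powR_gt0// normr_gt0 subr_eq0; exact/eqP.
    by move=> /eqP fx0; apply: fx; rewrite fx0.
have := integral_density fX.
rewrite (ae_eq_integral (cst 0))//; last exact/measurable_EFinP.
by rewrite integral0 => /eqP; rewrite eq_sym onee_eq0.
Qed.

Variables (r phi : R) (r2 : (2 <= r)%R) (phi01 : (0 <= phi <= 1)%R).

(** The pointwise bound at [y = k x] is integrated; the term in [pi(x - z)] is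
    moved back by [z], where it supplies the half of the absolute moment that
    the term in [pi(x)] leaves out. *)
Lemma overlap_affine_lt (z c : d.-tuple R) (m : R) : c <> zerov ->
  (`|dotv c z| `^ r)%:E *
    \int[lambda]_x (Num.min (phi * f x) ((1 - phi) * f (subv x z)))%:E
  < (2 `^ (r - 2))%:E * 'E_P[fun w => `|dotv c (X w) - m| `^ r]%R.
Proof.
move=> c0; have [mf f0 _] := fX.
have Epos := expectation_affine_powR_gt0 m r c0.
have rn0 : r != 0%R by rewrite gt_eqF// (lt_le_trans _ r2).
have C0 : (0 < 2 `^ (r - 2) :> R)%R by rewrite powR_gt0.
set L := dotv c z; have [L0|L0] := eqVneq L 0%R.
  by rewrite L0 normr0 powR0// mul0e mule_gt0 ?lte_fin.
have Lr0 : (0 < `|L| `^ r)%R by rewrite powR_gt0// normr_gt0.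
pose k x := ((dotv c x - m) / L)%R.
(* multiplying by [|L|^r] clears the denominator of [k]: [q] and [q'] are then
   the [r]-th powers of [|<c, x> - m|] on the two sides of the hyperplane
   [<c, x> = m] *)
pose q x := (`|L| `^ r * pos_powR r (k x))%R.
pose q' x := (`|L| `^ r * pos_powR r (- k x))%R.
pose g x := Num.min (phi * f x)%R ((1 - phi) * f (subv x z))%R.
pose g' x := (`|L| `^ r * g x)%R.
pose h x := (2 `^ (r - 2) * (q x * f x + q' (subv x z) * f (subv x z)))%R.
have fz0 x : (0 <= f (subv x z))%R by [].
have q0 x : (0 <= q x)%R by rewrite mulr_ge0 ?powR_ge0.
have q'0 x : (0 <= q' x)%R by rewrite mulr_ge0 ?powR_ge0.
have qq' x : (q x + q' x = `|dotv c x - m| `^ r)%R.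
  rewrite -mulrDr -powR_norm_split// -powRM ?normr_ge0// -normrM /k.
  by rewrite mulrC divfK.
have k1 x : (1 - k x = - k (subv x z))%R.
  by rewrite /k dotv_subv -/L; field.
have mk : measurable_fun setT k.
  apply: measurable_funM => //; apply: measurable_funB => //.
  exact: measurable_dotv.
have mpos : measurable_fun [set: R] (@pos_powR R r).
  apply: (@measurableT_comp _ _ _ _ _ _ (fun a => a `^ r)%R);
    first exact: measurable_powR.
  exact: measurable_maxr.
have mq : measurable_fun setT q.
  by apply: measurable_funM => //; exact: measurableT_comp mpos mk.
have mq' : measurable_fun setT q'.
  apply: measurable_funM => //; apply: (measurableT_comp mpos).
  exact: measurableT_comp mk.
have msub := @measurable_subv R d z.
have mfz : measurable_fun setT (fun x => f (subv x z)).
  exact: measurableT_comp mf msub.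
have mg : measurable_fun setT g.
  by apply: measurable_minr; apply: measurable_funM.
have mg' : measurable_fun setT g' by exact: measurable_funM.
have mqf : measurable_fun setT (fun x => q x * f x)%R by exact: measurable_funM.
have mqf' : measurable_fun setT (fun x => q' x * f x)%R.
  exact: measurable_funM.
have mqfz : measurable_fun setT (fun x => q' (subv x z) * f (subv x z))%R.
  exact: (measurableT_comp mqf' msub).
have mh : measurable_fun setT h.
  by apply: measurable_funM => //; exact: measurable_funD.
have g0 x : (0 <= g x)%R.
  by case/andP: phi01 => p0 p1; rewrite le_min !mulr_ge0// subr_ge0.
have [y0 y0P] := min_le_weighted_powR r2 phi01.
have hE x : h x = (`|L| `^ r * (2 `^ (r - 2) *
    (pos_powR r (k x) * f x + pos_powR r (1 - k x) * f (subv x z))))%R.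
  by rewrite /h /q /q' k1; ring.
have inth : \int[lambda]_x (h x)%:E =
    (2 `^ (r - 2))%:E * 'E_P[fun w => `|dotv c (X w) - m| `^ r]%R.
  rewrite expectation_affine_powR.
  under eq_integral do rewrite /h EFinM.
  rewrite ge0_integralZl//; last 2 first.
  - by apply/measurable_EFinP; exact: measurable_funD.
  - by move=> x _; rewrite lee_fin addr_ge0// mulr_ge0.
  congr (_ * _); under eq_integral do rewrite EFinD.
  rewrite ge0_integralD//; last 4 first.
  - by move=> x _; rewrite lee_fin mulr_ge0.
  - exact/measurable_EFinP.
  - by move=> x _; rewrite lee_fin mulr_ge0.
  - exact/measurable_EFinP.
  rewrite (@ge0_integral_lebesgue_tuple_shift R d z
    (fun x => (q' x * f x)%:E)); last 2 first.
  - exact/measurable_EFinP.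
  - by move=> x; rewrite lee_fin mulr_ge0.
  rewrite -ge0_integralD//; last 4 first.
  - by move=> x _; rewrite lee_fin mulr_ge0.
  - exact/measurable_EFinP.
  - by move=> x _; rewrite lee_fin mulr_ge0.
  - exact/measurable_EFinP.
  by apply: eq_integral => x _; rewrite -EFinD -mulrDl qq'.
have intg : (`|L| `^ r)%:E * \int[lambda]_x (g x)%:E = \int[lambda]_x (g' x)%:E.
  rewrite -ge0_integralZl//.
  - exact/measurable_EFinP.
  - by move=> x _; rewrite lee_fin.
rewrite -/g intg -inth.
(* the hyperplane is the locus where [k x = y0] *)
apply: (@ge0_integral_lt _ _ _ lambda g' h
  [set x | dotv c x = L * y0 + m]%R) => //.
- move=> x; rewrite mulr_ge0 ?powR_ge0//= hE ler_pM2l//.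
  exact: (y0P _ _ (k x) (f0 x) (fz0 x)).1.
- rewrite -[X in measurable X]setTI.
  exact: (measurable_dotv c measurableT (measurable_set1 _)).
- exact: lebesgue_tuple_hyperplane0.
- move=> x Nx; rewrite hE pmulr_rgt0// ltr_pM2l//.
  apply: (y0P _ _ (k x) (f0 x) (fz0 x)).2 => ky; apply: Nx => /=.
  by rewrite -ky /k mulrC divfK// subrK.
- rewrite -intg lte_mul_pinfty ?lee_fin ?powR_ge0//.
  apply: (@le_lt_trans _ _ (\int[lambda]_x (f x)%:E)).
    apply: ge0_le_integral => //.
    + by move=> x _; rewrite lee_fin.
    + exact/measurable_EFinP.
    + exact/measurable_EFinP.
    + move=> x _; rewrite lee_fin ge_min ler_piMl//.
      by case/andP: phi01.
  by rewrite (integral_density fX) ltry.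
- by rewrite inth mule_gt0.
Qed.

End overlap.

Theorem theoremA1 (R : realType) (d : nat) (d_ge1 : (1 <= d)%N)
  (disp : measure_display) (Omega : measurableType disp)
  (P : probability Omega R)
  (X0 : {RV P >-> d.-tuple R}) (f : d.-tuple R -> R)
  (f_density : is_density (lebesgue_tuple d) X0 f)
  (r : R) (r_ge2 : 2 <= r)
  (phi : R) (phi01 : 0 <= phi <= 1) (z : d.-tuple R) :
  (forall m : d.-tuple R,
    ((enorm z `^ r)%:E *
       \int[lebesgue_tuple d]_x
         (Num.min (phi * f x) ((1 - phi) * f (subv x z)))%:E
     < (2 `^ (r - 2))%:E *
       'E_P[fun w => (enorm (subv (X0 w) m) `^ r)%R])%E) /\
  (forall (c : d.-tuple R) (m : R), c <> zerov ->
    ((`|dotv c z| `^ r)%:E *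
       \int[lebesgue_tuple d]_x
         (Num.min (phi * f x) ((1 - phi) * f (subv x z)))%:E
     < (2 `^ (r - 2))%:E *
       'E_P[fun w => (`|dotv c (X0 w) - m| `^ r)%R])%E).
Proof.
split; last by move=> c m; exact: overlap_affine_lt.
move=> m.
(* [c = z] does, except for [z = 0], where any nonzero vector will do; one
   exists since the dimension is positive *)
have [c c0 cz] : exists2 c : d.-tuple R,
    c <> zerov & `|dotv c z| = enorm c * enorm z.
  have [->|z0] := pselect (z = zerov); last first.
    by exists z => //; rewrite dotv_self ger0_norm ?mulr_ge0 ?enorm_ge0.
  exists [tuple 1 | i < d].
    move=> /(congr1 (fun x => tnth x (Ordinal d_ge1))).
    by rewrite !tnth_mktuple => /eqP; rewrite oner_eq0.
  have dot0 x : dotv x zerov = 0 :> R.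
    by apply: big1 => i _; rewrite tnth_mktuple mulr0.
  by rewrite [X in _ * X]/enorm !dot0 sqrtr0 mulr0 normr0.
have N0 : 0 < enorm c `^ r by rewrite powR_gt0// enorm_gt0.
have := overlap_affine_lt f_density r_ge2 phi01 z (dotv c m) c0.
rewrite cz powRM ?enorm_ge0// EFinM -muleA => lt.
rewrite -(@lte_pmul2l _ (enorm c `^ r)%:E)//.
apply: (lt_le_trans lt).
rewrite [leRHS]muleCA lee_pmul2l ?lte_fin ?powR_gt0//.
have menorm : measurable_fun setT
    (fun w => (enorm (subv (X0 w) m) `^ r)%:E).
  apply/measurable_EFinP.
  apply: (@measurableT_comp _ _ _ _ _ _ (fun a => a `^ r)%R);
    first exact: measurable_powR.
  apply: (measurableT_comp measurable_enorm).
  exact: (measurableT_comp (measurable_subv m)).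
rewrite unlock -ge0_integralZl//; last 2 first.
- by move=> w _; rewrite lee_fin powR_ge0.
- by rewrite lee_fin ltW.
apply: ge0_le_integral => //.
- apply/measurable_EFinP.
  exact: (measurableT_comp (measurable_affine_powR c (dotv c m) r)).
- exact: emeasurable_funM.
- move=> w _; rewrite lee_fin -powRM ?enorm_ge0//.
  rewrite -dotv_subv ge0_ler_powR ?nnegrE ?mulr_ge0 ?enorm_ge0//; first lra.
  exact: dotv_cauchy_schwarz.
Qed.
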